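(* Let $n,k,r$ be positive integers with $n\ge 2r$. Then the algebra $\mathrm{MP}_{r,k}(n)$ is isomorphic to the algebra $\mathcal{A}_{r,k}(n)=\mathrm{End}_{\mathbb{C}S_n}(\mathcal{P}^r(V_{n,k}))$.
   Context: **The centralizer algebra.** $V_{n,k}=(\mathbb{C}^n)^k$, and $\mathcal{P}^r(V_{n,k})$ is the space of homogeneous polynomials of degree $r$ in the commuting variables $x_{ij}$, $1\le i\le n$, $1\le j\le k$, over $\mathbb{C}$. The symmetric group $S_n$ acts by permuting the first index: $\sigma\cdot x_{i_1j_1}\cdots x_{i_rj_r}=x_{\sigma(i_1)j_1}\cdots x_{\sigma(i_r)j_r}$. $\mathcal{A}_{r,k}(n)$ is the $\mathbb{C}$-algebra of all linear endomorphisms of $\mathcal{P}^r(V_{n,k})$ commuting with this action. **The multiset partition algebra.** Let $[k]=\{1,\dots,k\}$, $[\bar k]=\{\bar1,\dots,\bar k\}$, $[\bar{\bar k}]=\{\bar{\bar1},\dots,\bar{\bar k}\}$ be disjoint alphabets. A multiset partition of a multiset $S$ is a multiset of non-empty multisets (its blocks) whose multiset union is $S$. Its length $\ell(\pi)$ is the number of blocks counted with multiplicity; $m(\pi)!$ is the product, over the distinct blocks $T$ of $\pi$, of $m_T(\pi)!$, where $m_T(\pi)$ is the multiplicity of $T$ in $\pi$. $\Pi_{r,k}$ is the set of all multiset partitions of multisets consisting of $r$ elements from $[k]$ and $r$ elements from $[\bar k]$. $\Gamma_{r,k}$ is the set of all multiset partitions of multisets consisting of $r$ elements from each of $[k]$,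 $[\bar k]$, $[\bar{\bar k}]$. For a set $A$, $\nu|_A$ is obtained by restricting each block of $\nu$ to its elements in $A$ and discarding empty results. For $\gamma\in\Pi_{r,k}$, $\bar\gamma$ is obtained by adding one bar to every entry. For $\nu\in\Gamma_{r,k}$, $\nu|_{[k]\cup[\bar{\bar k}]}$ is regarded as an element of $\Pi_{r,k}$ by removing one bar from each doubly barred entry. For $\nu\in\Gamma_{r,k}$ and each distinct block $S$ of $\nu|_{[k]\cup[\bar{\bar k}]}$, let $\nu_S$ be the multiset of blocks $T$ of $\nu$ (with multiplicity) with $T|_{[k]\cup[\bar{\bar k}]}=S$. Let $\beta$ be the multiset of blocks of $\nu$ all of whose elements lie in $[\bar k]$. Define $$a_\nu=\prod_S\frac{\ell(\nu_S)!}{m(\nu_S)!},\qquad b_\nu(x)=\frac{(x-\ell(\nu|_{[k]\cup[\bar{\bar k}]}))_{\ell(\beta)}}{m(\beta)!},$$ with $S$ ranging over the distinct blocks of $\nu|_{[k]\cup[\bar{\bar k}]}$ and $(a)_s=a(a-1)\cdots(a-s+1)$. $\mathrm{MP}_{r,k}(n)$ is the $\mathbb{C}$-algebra with basis $\{X_\pi:\pi\in\Pi_{r,k}\}$ and product $$X_\pi\cdot X_\gamma=\sum_{\nu}a_\nu b_\nu(n)X_{\nu|_{[k]\cup[\bar{\bar k}]}},$$ summed over all $\nu\in\Gamma_{r,k}$ with $\nu|_{[k]\cup[\bar k]}=\pi$ and $\nu|_{[\bar k]\cup[\bar{\bar k}]}=\bar\gamma$ (i.e. the specialization at $x=n$ of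 the structure constants $a_\nu b_\nu(x)$, which are polynomials in $x$). *)

(* Defs.v *)
From HB Require Import structures.
From mathcomp Require Import all_boot all_order all_algebra all_fingroup.
From mathcomp Require Import finmap multiset.
From mathcomp.multinomials Require Import mpoly.

Set Implicit Arguments.
Unset Strict Implicit.
Unset Printing Implicit Defensive.

Import GRing.Theory.
Local Open Scope mset_scope.
Local Open Scope nat_scope.

(* The letter (b, j) is the integer j carrying b bars: [k], [\bar k] and
   [\bar\bar k] are the letters with 0, 1 and 2 bars respectively. *)
Notation letter k := ('I_3 * 'I_k)%type.
Notation mpart k := {mset {mset letter k}}.

(* B lists the numbers of bars of the letters that are kept; e.g. restr [:: 0; 2]
   restricts to the union of [k] and [\bar\bar k]. *)
Definition restr_block k (B : seq nat) (T : {mset letter k}) :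
    {mset letter k} :=
  seq_mset [seq x : letter k <- T | (x.1 : nat) \in B].

Definition restr k (B : seq nat) (nu : mpart k) : mpart k :=
  seq_mset [seq S <- [seq restr_block B T | T : {mset letter k} <- nu]
           | S != mset0].

Definition relabel k (f : letter k -> letter k) (nu : mpart k) : mpart k :=
  seq_mset [seq seq_mset [seq f x | x : letter k <- T]
           | T : {mset letter k} <- nu].

(* Only applied to letters with at most one bar, on which ordS is i |-> i + 1. *)
Definition add_bar k (x : letter k) : letter k := (ordS x.1, x.2).

Definition unbar2 k (x : letter k) : letter k :=
  if x.1 == 2 :> nat then (inord 1, x.2) else x.

Definition munion k (nu : mpart k) : {mset letter k} :=
  seq_mset (flatten [seq enum_mset T | T : {mset letter k} <- nu]).

(* nu is a multiset partition of a multiset consisting of r elements from each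
   of the first c alphabets, and none from the others: c = 2 gives Pi_{r,k} and
   c = 3 gives Gamma_{r,k}. *)
Definition is_mpart (c r k : nat) (nu : mpart k) : bool :=
  (mset0 \notin nu) &&
  [forall b : 'I_3,
     count (fun x : letter k => x.1 == b) (munion nu)
       == (if b < c then r else 0)].

Record mparts (c r k : nat) := MParts {
  mpart_of :> mpart k;
  mpart_ofP : is_mpart c r mpart_of }.

HB.instance Definition _ c r k := [isSub for @mpart_of c r k].
HB.instance Definition _ c r k := [Choice of mparts c r k by <:].

Lemma count_seq_mset (K : choiceType) (p : pred K) (s : seq K) :
  count p (seq_mset s) = count p s.
Proof. exact/seq.permP/perm_eq_seq_mset. Qed.

Lemma count_munion k (p : pred (letter k)) (nu : mpart k) :
  count p (munion nu) = \sum_(T <- enum_mset nu) count p (enum_mset T).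
Proof. by rewrite count_seq_mset count_flatten sumnE !big_map. Qed.

Section FiniteMParts.
Variables c r k : nat.
Let N := 3 * r.

Lemma size_munion_le (nu : mpart k) :
  is_mpart c r nu -> \sum_(T <- enum_mset nu) size (enum_mset T) <= N.
Proof.
case/andP=> _ /forallP h.
under eq_bigr do rewrite -count_predT.
rewrite -count_munion.
have -> : count predT (munion nu)
    = \sum_(b < 3) count (fun x : letter k => x.1 == b) (munion nu).
  elim: (enum_mset (munion nu)) => [|x s IH] /=; first by rewrite big1.
  rewrite big_split /= -IH (bigD1 x.1) //= eqxx big1 // => b.
  by rewrite eq_sym => /negPf->.
rewrite /N -[in leqRHS](card_ord 3) -sum_nat_const.
by apply: leq_sum => b _; rewrite (eqP (h b)); case: ifP.
Qed.

Lemma size_block_le (nu : mpart k) (T : {mset letter k}) :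
  is_mpart c r nu -> T \in nu -> size T <= N.
Proof.
move=> /size_munion_le le_N T_nu; apply: leq_trans le_N.
by rewrite (big_rem T) //= leq_addr.
Qed.

Lemma size_mpart_le (nu : mpart k) : is_mpart c r nu -> size nu <= N.
Proof.
move=> nuP; apply: leq_trans (size_munion_le nuP).
rewrite -sum1_size big_seq [leqRHS]big_seq; apply: leq_sum => T T_nu.
rewrite lt0n size_eq0; apply: contraTN T_nu => /eqP T0.
by case/andP: nuP; rewrite -[T]seq_mset_id T0 -[mset0]seq_mset_id enum_mset0.
Qed.

Definition mparts_code (nu : mparts c r k) : N.-bseq (N.-bseq (letter k)) :=
  insub_bseq N [seq insub_bseq N (enum_mset T) | T <- enum_mset nu].

Definition mparts_decode (s : N.-bseq (N.-bseq (letter k))) :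
    option (mparts c r k) :=
  insub (seq_mset [seq seq_mset t | t : N.-bseq (letter k) <- s]).

Lemma mparts_codeK : pcancel mparts_code mparts_decode.
Proof.
move=> nu; rewrite /mparts_decode /mparts_code /insub_bseq.
rewrite insubdK; last first.
  by rewrite unfold_in size_map (size_mpart_le (mpart_ofP nu)).
rewrite -map_comp; set s := (X in seq_mset X).
have -> : s = enum_mset nu.
  rewrite /s -[RHS]map_id; apply/eq_in_map => T T_nu /=.
  rewrite insubdK ?seq_mset_id // unfold_in.
  exact: size_block_le (mpart_ofP nu) T_nu.
by rewrite seq_mset_id valK.
Qed.

HB.instance Definition _ :=
  Countable.copy (mparts c r k) (pcan_type mparts_codeK).
HB.instance Definition _ :=
  isFinite.Build (mparts c r k) (pcan_enumP mparts_codeK).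

End FiniteMParts.

Lemma outer_subproof r k (nu : mparts 3 r k) :
  is_mpart 2 r (relabel (@unbar2 k) (restr [:: 0; 2] nu)).
Proof.
case: nu => nu /= /andP[nu0 /forallP h]; apply/andP; split.
  apply/negP; rewrite (perm_mem (perm_eq_seq_mset _)) => /mapP[/= S].
  rewrite (perm_mem (perm_eq_seq_mset _)) mem_filter => /andP[S0 _].
  move/(congr1 (fun A : {mset letter k} => size A)).
  rewrite (perm_size (perm_eq_seq_mset _)) size_map enum_mset0 => /esym/eqP.
  rewrite size_eq0 => /eqP S00; case/negP: S0.
  by rewrite -[S]seq_mset_id S00 -[mset0]seq_mset_id enum_mset0.
apply/forallP => b; rewrite count_munion.
rewrite (perm_big _ (perm_eq_seq_mset _)) big_map /=.
under eq_bigr do rewrite count_seq_mset count_map.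
rewrite (perm_big _ (perm_eq_seq_mset _)) big_filter /=.
rewrite big_mkcond big_map /=.
pose q (x : letter k) := ((x.1 : nat) \in [:: 0; 2]) && ((unbar2 x).1 == b).
rewrite (eq_bigr (fun T => count q (enum_mset T))); last first.
  move=> T _; rewrite count_seq_mset count_filter.
  rewrite (eq_count (a2 := q)); last by move=> x; rewrite /= andbC.
  case: eqP => //= S0; symmetry; apply/eqP; rewrite eqn0Ngt -has_count.
  apply/hasPn => x xT; rewrite /q negb_and; apply/orP; left.
  apply/negP => xB; have : x \in restr_block [:: 0; 2] T.
    by rewrite (perm_mem (perm_eq_seq_mset _)) mem_filter xB.
  by rewrite S0 in_mset0.
rewrite -count_munion.
have q_i (i : 'I_3) : q =1 (fun x : letter k => x.1 == i) ->
    count q (munion nu) == r.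
  by move=> /eq_count->; rewrite (eqP (h i)) ltn_ord.
have inord1 : inord 1 = Ordinal (isT : 1 < 3) by apply/val_inj; rewrite /= inordK.
case: b @q q_i => [[|[|[|//]]] lt_b] q q_i /=.
- by apply: (q_i ord0) => -[[[|[|[|//]]] ?] j]; rewrite /q /unbar2 /= ?inord1.
- by apply: (q_i ord_max) => -[[[|[|[|//]]] ?] j]; rewrite /q /unbar2 /= ?inord1.
rewrite (eq_count (a2 := pred0)) ?count_pred0 //.
by move=> -[[[|[|[|//]]] ?] j]; rewrite /q /unbar2 /= ?inord1.
Qed.

(* The partition nu|_([k] U [\bar\bar k]), seen in Pi_{r,k}. *)
Definition outer r k (nu : mparts 3 r k) : mparts 2 r k :=
  MParts (outer_subproof nu).

(* pi T is the multiplicity of the block T in pi. *)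
Definition mfact k (pi : mpart k) : nat :=
  \prod_(T <- finsupp pi) (pi T)`!.

(* The multiset nu_S of the blocks of nu restricting to S. *)
Definition fiber k (nu : mpart k) (S : {mset letter k}) : mpart k :=
  seq_mset [seq T : {mset letter k} <- nu | restr_block [:: 0; 2] T == S].

(* The multiset beta of the blocks of nu contained in [\bar k]. *)
Definition middle k (nu : mpart k) : mpart k :=
  seq_mset [seq T : {mset letter k} <- nu
           | all (fun x : letter k => x.1 == 1 :> nat) T].

Local Open Scope ring_scope.

Definition falling (C : fieldType) (a : C) (s : nat) : C :=
  \prod_(i < s) (a - i%:R).

Definition a_coef (C : fieldType) k (nu : mpart k) : C :=
  \prod_(S <- finsupp (restr [:: 0; 2]%N nu))
    ((size (fiber nu S))`!%:R / (mfact (fiber nu S))%:R).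

Definition b_coef (C : fieldType) k (nu : mpart k) (x : C) : C :=
  falling (x - (size (restr [:: 0; 2]%N nu))%:R) (size (middle nu))
    / (mfact (middle nu))%:R.

Section MultisetPartitionAlgebra.
Variables (C : fieldType) (r k n : nat).

Definition MP : Type := {ffun mparts 2 r k -> C^o}.
HB.instance Definition _ := GRing.Lmodule.on MP.

Definition mpX (pi : mparts 2 r k) : MP := [ffun rho => (rho == pi)%:R].

Definition mp_mulX (pi gamma : mparts 2 r k) : MP :=
  \sum_(nu : mparts 3 r k | (restr [:: 0; 1]%N nu == mpart_of pi)
                         && (restr [:: 1; 2]%N nu == relabel (@add_bar k) gamma))
    (a_coef C nu * b_coef nu (n%:R : C)) *: mpX (outer nu).

Definition mp_mul (u v : MP) : MP :=
  \sum_pi \sum_gamma (u pi * v gamma) *: mp_mulX pi gamma.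

End MultisetPartitionAlgebra.

Section CentralizerAlgebra.
Variables (C : fieldType) (n k r : nat).

(* The variable x_ij is 'X_(mxvec_index i j). *)
Definition hpoly : Type := dhomog (n * k)%N C r.
HB.instance Definition _ := GRing.Lmodule.on hpoly.

Definition hmonom := {m : 'X_{1..(n * k)%N < r.+1} | mdeg m == r}.

Lemma hpoly_vect_axiom : vector_axiom #|{: hmonom}| hpoly.
Proof.
pose M (i : 'I_#|{: hmonom}|) : 'X_{1..(n * k)%N} := val (val (enum_val i)).
exists (fun p : hpoly => \row_i (val p)@_(M i)) => [c p q|].
  by apply/rowP => i; rewrite !mxE /= mcoeffD mcoeffZ.
pose g (v : 'rV[C]_#|{: hmonom}|) := \sum_i v 0 i *: 'X_[C, M i].
have gP v : g v \is r.-homog.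
  by apply: rpred_sum => i _; apply/rpredZ; rewrite dhomogX (valP (enum_val i)).
have M_inj : injective M by move=> i j /val_inj/val_inj/enum_val_inj.
exists (fun v => DHomog (gP v) : hpoly) => [p|v]; last first.
  apply/rowP => i; rewrite mxE /= raddf_sum (bigD1 i) //= mcoeffZ mcoeffX eqxx.
  rewrite mulr1 big1 ?addr0 // => j ji.
  by rewrite mcoeffZ mcoeffX (inj_eq M_inj) (negPf ji) mulr0.
apply/val_inj/mpolyP => m /=; rewrite /g raddf_sum /=.
have [mr|mr] := eqVneq (mdeg m) r; last first.
  rewrite (dhomog_nemf_coeff (valP p) mr) big1 // => i _.
  rewrite mcoeffZ mcoeffX; case: eqP => [mE|_]; last by rewrite mulr0.
  by rewrite -mE (eqP (valP (enum_val i))) eqxx in mr.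
have ltm : (mdeg m < r.+1)%N by rewrite mr.
have hm : mdeg (BMultinom ltm) == r by rewrite /= mr.
pose i : 'I_#|{: hmonom}| := enum_rank (Sub (BMultinom ltm) hm : hmonom).
have Mi : M i = m by rewrite /M enum_rankK.
rewrite (bigD1 i) //= mcoeffZ mcoeffX Mi eqxx mulr1 mxE Mi.
rewrite big1 ?addr0 // => j ji.
by rewrite mcoeffZ mcoeffX -Mi (inj_eq M_inj) (negPf ji) mulr0.
Qed.

HB.instance Definition _ := Lmodule_hasFinDim.Build C hpoly hpoly_vect_axiom.

(* The substitution x_ij |-> x_(sigma i)j; the matrix of images is flattened by
   mxvec, consistently with mxvec_index. *)
Definition sym_subst (sigma : 'S_n) : (n * k)%N.-tuple {mpoly C[(n * k)%N]} :=
  [tuple mxvec (\matrix_(i < n, j < k) 'X_(mxvec_index (sigma i) j)) 0 l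
  | l < (n * k)%N].

Lemma sym_act_homog (sigma : 'S_n) (p : hpoly) :
  val p \mPo sym_subst sigma \is r.-homog.
Proof.
rewrite comp_mpolyEX big_seq; apply: rpred_sum => m m_p; apply: rpredZ.
have <- : mdeg m = r by exact: (dhomog_mf (valP p) m_p).
rewrite comp_mpolyX mdegE; elim/big_ind2: _ => [|d p1 e p2 h1 h2|l _].
- exact: dhomog1.
- exact: dhomogM.
suff h : tnth (sym_subst sigma) l \is 1.-homog.
  by have := dhomogMn (m l) h; rewrite mul1n.
rewrite tnth_mktuple; case/mxvec_indexP: l => i j.
by rewrite mxvecE mxE dhomogX; apply/eqP; exact: mdeg1.
Qed.

Definition sym_act (sigma : 'S_n) (p : hpoly) : hpoly :=
  DHomog (sym_act_homog sigma p).

Lemma sym_act_is_linear sigma : linear (sym_act sigma).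
Proof. by move=> c p q; apply: val_inj; rewrite /= linearP. Qed.

HB.instance Definition _ sigma :=
  GRing.isLinear.Build C hpoly hpoly _ (sym_act sigma) (sym_act_is_linear sigma).

Definition centralizes : {pred 'End(hpoly)} :=
  fun f => [forall sigma : 'S_n,
    f \o linfun (sym_act sigma) == linfun (sym_act sigma) \o f]%VF.

Record centralizer := Centralizer {
  centralizer_lfun :> 'End(hpoly);
  centralizer_lfunP : centralizer_lfun \in centralizes }.

HB.instance Definition _ := [isSub for centralizer_lfun].
HB.instance Definition _ := [Choice of centralizer by <:].

Lemma centralizes_submod : submod_closed centralizes.
Proof.
split=> [|c f g]; first by apply/forallP => s; rewrite comp_lfun0l comp_lfun0r.
move=> /forallP hf /forallP hg; apply/forallP => s.
rewrite comp_lfunDl comp_lfunDr -comp_lfunZl -comp_lfunZr.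
by rewrite (eqP (hf s)) (eqP (hg s)).
Qed.
HB.instance Definition _ :=
  GRing.isSubmodClosed.Build C 'End(hpoly) centralizes centralizes_submod.
HB.instance Definition _ := [SubChoice_isSubLmodule of centralizer by <:].

Lemma centralizes_comp (f g : centralizer) :
  (centralizer_lfun f \o centralizer_lfun g)%VF \in centralizes.
Proof.
case: f g => [f hf] [g hg] /=; move/forallP: hf; move/forallP: hg => hg hf.
apply/forallP => s.
by rewrite -comp_lfunA (eqP (hg s)) !comp_lfunA (eqP (hf s)).
Qed.

Definition centralizer_mul (f g : centralizer) : centralizer :=
  Centralizer (centralizes_comp f g).

End CentralizerAlgebra.

(* A linear bijection compatible with the products; it necessarily transports
   associativity and units. *)
Definition algebra_isomorphic (C : fieldType) (A B : lmodType C)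
    (mulA : A -> A -> A) (mulB : B -> B -> B) : Prop :=
  exists f : {linear A -> B},
    bijective f /\ {morph f : x y / mulA x y >-> mulB x y}.

(* Main.v *)
Require Import Defs.
From HB Require Import structures.
From mathcomp Require Import all_boot all_order all_algebra all_fingroup.
From mathcomp Require Import finmap multiset.
From mathcomp.multinomials Require Import mpoly.
From mathcomp Require Import reals complex.

(* A pair of monomials (m, m') of degree r is the n-tuple of its columns: column
   i is the multiset of letters j and \bar j with multiplicities the exponents
   of x_ij in m and in m'. The orbits of S_n on such pairs are classified by the
   multiset of non-empty columns, an element of Pi_{r,k}, and n >= 2r ensures
   that every element of Pi_{r,k} occurs. So sending X_pi to the 0/1 matrix
   supported by the orbit pi is a linear isomorphism onto the centralizer.
   The product of two orbit matrices counts, for fixed (m, m''), the monomials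
   m' such that the triple (m, m', m'') has a given type nu. By transitivity this
   number is the quotient of the sizes of the orbits of nu and of
   rho = nu|_([k] U [\bar\bar k]), which by orbit-counting are
   n! / (m(nu)! (n - l(nu))!) and n! / (m(rho)! (n - l(rho))!); the quotient is
   exactly a_nu b_nu(n), both being 0 when l(nu) > n. *)

Set Implicit Arguments.
Unset Strict Implicit.
Unset Printing Implicit Defensive.

Import GRing.Theory Num.Theory.

Local Open Scope mset_scope.
Local Open Scope nat_scope.

(** * Products of factorials of multiplicities *)

Definition mult_fact (T : eqType) (s : seq T) : nat :=
  \prod_(x <- undup s) (count_mem x s)`!.

(** Values absent from [s] contribute 0! = 1. This lets two lists be compared over a common index
    set. *)
Lemma mult_factE (T : eqType) (s t : seq T) :
  uniq t -> {subset s <= t} -> mult_fact s = \prod_(x <- t) (count_mem x s)`!.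
Proof.
move=> t_uniq st; rewrite (bigID (mem s)) /= [X in _ * X]big1 ?muln1; last first.
  by move=> x /count_memPn->.
rewrite -[RHS]big_filter; apply: perm_big; apply: uniq_perm.
- exact: undup_uniq.
- exact: filter_uniq.
move=> x; rewrite mem_undup mem_filter; case: (boolP (x \in s)) => //= xs.
by rewrite st.
Qed.

Lemma mult_fact_gt0 (T : eqType) (s : seq T) : 0 < mult_fact s.
Proof. by apply: prodn_gt0 => x; apply: fact_gt0. Qed.

Lemma mult_fact_rem (T : eqType) (s : seq T) (x : T) :
  x \in s -> mult_fact s = count_mem x s * mult_fact (rem x s).
Proof.
move=> xs; rewrite (@mult_factE _ (rem x s) (undup s)) ?undup_uniq //; last first.
  by move=> y /mem_rem; rewrite mem_undup.
rewrite /mult_fact (bigD1_seq x) ?mem_undup ?undup_uniq //=.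
rewrite [in RHS](bigD1_seq x) ?mem_undup ?undup_uniq //= mulnA.
congr (_ * _).
  by rewrite (seq.permP (perm_to_rem xs)) /= eqxx add1n factS.
apply: eq_bigr => y yx; rewrite (seq.permP (perm_to_rem xs)) /=.
by rewrite eq_sym (negPf yx).
Qed.

(** The multinomial coefficient, by induction on the size: permutations are sorted by their first
    entry [x]. Those starting with [x] contribute [count_mem x s] times (size - 1)!, and the
    multiplicities add up to the size. *)
Lemma size_permutations_mult_fact (T : eqType) (s : seq T) :
  size (permutations s) * mult_fact s = (size s)`!.
Proof.
elim: {s}_.+1 {-2}s (ltnSn (size s)) => // n IH s.
case: (posnP (size s)) => [/size0nil-> _|s_gt0 sn].
  by rewrite /mult_fact big_nil.
rewrite (perm_size (permutationsE s_gt0)) size_allpairs_dep sumnE big_map.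
rewrite big_distrl /=.
transitivity (\sum_(x <- undup s) count_mem x s * (size s).-1`!).
  rewrite big_seq [RHS]big_seq; apply: eq_bigr => x; rewrite mem_undup => xs.
  rewrite (mult_fact_rem xs) mulnCA IH ?size_rem //.
  by rewrite -ltnS prednK.
rewrite -big_distrl /= -[in RHS](prednK s_gt0) factS prednK //; congr (_ * _).
rewrite -sum1_size -[RHS]big_undup_iterop_count; apply: eq_bigr => x _.
by rewrite Monoid.iteropE iter_addn addn0 mul1n.
Qed.

(** Applied with [x] the empty block, it isolates the factor (n - l(nu))! due to the empty
    columns. *)
Lemma mult_fact_cat_nseq (T : eqType) (s : seq T) (x : T) (m : nat) :
  x \notin s -> mult_fact (nseq m x ++ s) = m`! * mult_fact s.
Proof.
move=> xs.
have h (t : seq T) : {subset t <= x :: s} ->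
    mult_fact t = \prod_(y <- x :: undup s) (count_mem y t)`!.
  move=> ts; apply: mult_factE; first by rewrite /= undup_uniq mem_undup xs.
  by move=> y /ts; rewrite !inE mem_undup.
rewrite h; last first.
  move=> y; rewrite mem_cat inE => /orP[/nseqP[-> _]|->]; last exact: orbT.
  by rewrite eqxx.
rewrite (h s); last by move=> y ys; rewrite inE ys orbT.
rewrite !big_cons count_cat count_nseq /= eqxx mul1n (count_memPn xs) addn0.
rewrite fact0 mul1n; congr (_ * _); rewrite big_seq [RHS]big_seq.
apply: eq_bigr => y; rewrite mem_undup count_cat count_nseq /=.
by case: eqP => // <-; rewrite (negPf xs).
Qed.

Lemma mfactE k (s : seq {mset letter k}) : mfact (seq_mset s) = mult_fact s.
Proof.
rewrite /mfact (@mult_factE _ _ (finsupp (seq_mset s))) ?fset_uniq //.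
  by apply: eq_bigr => T _; rewrite mset_seqE.
by move=> T Ts; rewrite multiset.msuppE (perm_mem (perm_eq_seq_mset _)).
Qed.

(** * Multisets of blocks as orbits of column tuples *)

Lemma seq_mset_perm (T : choiceType) (s t : seq T) :
  perm_eq s t -> seq_mset s = seq_mset t.
Proof. by move/eq_seq_msetP. Qed.

Lemma size_seq_mset (T : choiceType) (s : seq T) : size (seq_mset s) = size s.
Proof. exact/perm_size/perm_eq_seq_mset. Qed.

Lemma mem_seq_mset (T : choiceType) (s : seq T) : seq_mset s =i s.
Proof. exact/perm_mem/perm_eq_seq_mset. Qed.

Lemma seq_mset0 (T : choiceType) : seq_mset [::] = mset0 :> {mset T}.
Proof. by rewrite -[RHS]seq_mset_id enum_mset0. Qed.

Lemma mset_nil (T : choiceType) (A : {mset T}) : (A == mset0) = nilp A.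
Proof.
apply/eqP/nilP => [->|A0]; first exact: enum_mset0.
by rewrite -[A]seq_mset_id A0 seq_mset0.
Qed.

(** Dropping the empty columns loses nothing: as [n] is fixed, their number is n minus the number of
    blocks. *)
Definition col_type n k (v : 'I_n -> {mset letter k}) : mpart k :=
  seq_mset [seq T <- [seq v i | i <- enum 'I_n] | T != mset0].

Definition relabel_block k (f : letter k -> letter k) (T : {mset letter k}) :
    {mset letter k} := seq_mset [seq f x | x : letter k <- T].

Lemma eq_col_type n k (v w : 'I_n -> {mset letter k}) :
  v =1 w -> col_type v = col_type w.
Proof. by move=> vw; rewrite /col_type (eq_map vw). Qed.

Lemma restr_block0 k B : restr_block B (mset0 : {mset letter k}) = mset0.
Proof. by rewrite /restr_block enum_mset0 seq_mset0. Qed.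

Lemma restr_blockE k B (T : {mset letter k}) x :
  restr_block B T x = if (x.1 : nat) \in B then T x else 0.
Proof.
rewrite mset_seqE count_filter -count_mem_mset .
case: ifP => xB.
  by apply: eq_count => y /=; case: eqP => // ->; rewrite xB.
apply/eqP; rewrite eqn0Ngt -has_count; apply/hasPn => y _ /=.
by case: eqP => // ->; rewrite xB.
Qed.

(** The empty columns may be dropped before or after restricting, since an empty column restricts to
    an empty one. *)
Lemma restr_col_type n k B (v : 'I_n -> {mset letter k}) :
  restr B (col_type v) = col_type (fun i => restr_block B (v i)).
Proof.
rewrite /restr /col_type (map_comp (restr_block B) v); move: (map v _) => s.
apply: seq_mset_perm; rewrite (perm_trans (perm_filter _ (perm_map _ (perm_eq_seq_mset _)))) //.
rewrite !filter_map -filter_predI; apply/seq.permP => p; congr (count p _).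
congr map; apply: eq_filter => T /=.
by case: eqP => //= T0; case: eqP => // TT; rewrite TT restr_block0 in T0.
Qed.

Lemma count_sum_mem (T : finType) (p : pred T) (s : seq T) :
  count p s = \sum_(x | p x) count_mem x s.
Proof.
elim: s => [|y s IH] /=; first by rewrite big1.
rewrite IH big_split /=; congr (_ + _).
case: (boolP (p y)) => py.
  rewrite (bigD1 y) //= eqxx big1 // => x /andP[_].
  by rewrite eq_sym => /negPf->.
rewrite big1 // => x px; case: eqP => // yx; by rewrite yx px in py.
Qed.

Lemma relabel_blockE k (f : letter k -> letter k) (T : {mset letter k}) y :
  relabel_block f T y = \sum_(x | f x == y) T x.
Proof.
rewrite mset_seqE count_map count_sum_mem.
by apply: eq_bigr => x _; rewrite count_mem_mset.
Qed.

Lemma relabel_block_nil k (f : letter k -> letter k) (T : {mset letter k}) :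
  (relabel_block f T == mset0) = (T == mset0).
Proof. by rewrite !mset_nil /nilp size_seq_mset size_map. Qed.

Lemma relabel_col_type n k f (v : 'I_n -> {mset letter k}) :
  relabel f (col_type v) = col_type (fun i => relabel_block f (v i)).
Proof.
rewrite /relabel /col_type (map_comp (relabel_block f) v); move: (map v _) => s.
apply: seq_mset_perm; rewrite (perm_trans (perm_map _ (perm_eq_seq_mset _))) //.
rewrite filter_map; apply/seq.permP => p; congr (count p _).
by congr map; apply: eq_filter => T /=; rewrite relabel_block_nil.
Qed.

Lemma relabel_block_comp k (f g : letter k -> letter k) (T : {mset letter k}) :
  relabel_block g (relabel_block f T) = relabel_block (g \o f) T.
Proof.
apply: seq_mset_perm; rewrite (perm_trans (perm_map _ (perm_eq_seq_mset _))) //.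
by rewrite -map_comp.
Qed.

(** Cancellation is asked only on the letters that occur, because [rebar2] undoes [unbar2] only on
    letters with 0 or 2 bars. *)
Lemma relabelK_in k (f g : letter k -> letter k) (nu : mpart k) :
  {in munion nu, cancel f g} -> relabel g (relabel f nu) = nu.
Proof.
move=> fg; rewrite -[RHS]seq_mset_id; apply: seq_mset_perm.
rewrite (perm_trans (perm_map _ (perm_eq_seq_mset _))) // -map_comp.
rewrite -[X in perm_eq _ X]map_id; apply/seq.permP => p; congr (count p _).
apply/eq_in_map => T Tnu /=; rewrite -[RHS]seq_mset_id.
rewrite -/(relabel_block _ _) relabel_block_comp; congr seq_mset.
rewrite -[RHS]map_id; apply/eq_in_map => x xT /=; apply: fg.
by rewrite mem_seq_mset; apply/flattenP; exists (enum_mset T) => //; apply: map_f.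
Qed.

Lemma col_type_mset0 n k (v : 'I_n -> {mset letter k}) : mset0 \notin col_type v.
Proof. by rewrite mem_seq_mset mem_filter eqxx. Qed.

Lemma count_munion_col_type n k (p : pred (letter k)) (v : 'I_n -> {mset letter k}) :
  count p (munion (col_type v)) = \sum_i count p (v i).
Proof.
rewrite count_munion (perm_big _ (perm_eq_seq_mset _)) big_filter big_mkcond /=.
rewrite big_map big_enum /=; apply: eq_bigr => i _.
by case: eqP => // ->; rewrite enum_mset0.
Qed.

(** Restores the empty columns dropped by [col_type]. With more than [n] blocks the truncated
    difference is 0 and the list is too long, hence the bounds [size nu <= n] below. *)
Definition padded n k (nu : mpart k) : seq {mset letter k} :=
  nseq (n - size nu) mset0 ++ nu.

Lemma size_padded n k (nu : mpart k) : size nu <= n -> size (padded n nu) = n.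
Proof. by move=> le_n; rewrite size_cat size_nseq subnK. Qed.

Lemma col_type_size n k (v : 'I_n -> {mset letter k}) : size (col_type v) <= n.
Proof.
rewrite size_seq_mset size_filter (leq_trans (count_size _ _)) //.
by rewrite size_map size_enum_ord.
Qed.

Lemma col_type_padded n k (v : 'I_n -> {mset letter k}) :
  perm_eq [seq v i | i <- enum 'I_n] (padded n (col_type v)).
Proof.
rewrite /padded; set s := map v _.
have sn : size s = n by rewrite size_map size_enum_ord.
have -> : n - size (col_type v) = count (pred1 mset0) s.
  rewrite size_seq_mset size_filter -{1}sn -(count_predC (pred1 mset0) s).
  by rewrite addnK.
rewrite perm_sym (perm_trans (perm_cat (perm_refl _) (perm_eq_seq_mset _))) //.
rewrite perm_sym -(perm_filterC (pred1 mset0)) perm_cat2r.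
rewrite [X in perm_eq X](_ : _ = nseq (count (pred1 mset0) s) mset0) //.
by rewrite -size_filter; apply/all_pred1P/filter_all.
Qed.

(** Turns the tuples of type [nu] into the rearrangements of one list, which can be counted. *)
Lemma col_typeP n k (v : 'I_n -> {mset letter k}) (nu : mpart k) :
  mset0 \notin nu -> size nu <= n ->
  (col_type v == nu) = perm_eq [seq v i | i <- enum 'I_n] (padded n nu).
Proof.
move=> nu0 nun; apply/eqP/idP => [<-|]; first exact: col_type_padded.
move=> /(perm_filter (fun T => T != mset0)) /seq_mset_perm.
rewrite -/(col_type v) => ->; rewrite -[RHS]seq_mset_id; congr seq_mset.
rewrite filter_cat (eq_in_filter (a2 := pred0)) ?filter_pred0 /=; last first.
  by move=> T /nseqP[-> _]; rewrite eqxx.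
rewrite (eq_in_filter (a2 := predT)) ?filter_predT // => T Tnu /=.
by apply: contraNneq nu0 => <-.
Qed.

(** The type is a complete invariant of the S_n-orbit: both tuples rearrange the same padded
    list. *)
Lemma col_type_eq_perm n k (v w : 'I_n -> {mset letter k}) :
  col_type v = col_type w -> exists s : 'S_n, forall i, w i = v (s i).
Proof.
move=> vw; have : perm_eq [tuple w i | i < n] [tuple v i | i < n].
  rewrite /= (perm_trans (col_type_padded w)) // -vw perm_sym.
  exact: col_type_padded.
move=> /tuple_permP[s /eqP]; rewrite -[_ == _]/(_ == _ :> _.-tuple _) => /eqP ws.
exists s => i; move/(congr1 (fun t => tnth t i)): ws.
by rewrite !tnth_mktuple.
Qed.

Lemma col_type_perm n k (v : 'I_n -> {mset letter k}) (s : 'S_n) :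
  col_type (fun i => v (s i)) = col_type v.
Proof.
apply: seq_mset_perm; apply: perm_filter.
suff: perm_eq [tuple v (s i) | i < n] [tuple v i | i < n] by [].
by apply/tuple_permP; exists s; congr val; apply: eq_mktuple => i; rewrite tnth_mktuple.
Qed.

Lemma map_nth_ord (T : Type) (x0 : T) n (s : seq T) :
  size s = n -> [seq nth x0 s i | i : 'I_n <- enum 'I_n] = s.
Proof.
move=> sn; apply: (@eq_from_nth _ x0) => [|i]; first by rewrite size_map size_enum_ord.
rewrite size_map size_enum_ord => lt_in.
by rewrite (nth_map (Ordinal lt_in)) ?size_enum_ord // nth_enum_ord.
Qed.

Lemma col_type_surj n k (nu : mpart k) :
  mset0 \notin nu -> size nu <= n ->
  exists v : 'I_n -> {mset letter k}, col_type v = nu.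
Proof.
move=> nu0 nun; exists (fun i => nth mset0 (padded n nu) i); apply/eqP.
by rewrite col_typeP // map_nth_ord ?size_padded.
Qed.

(** Orbit counting without division: the second factor is the order of the stabiliser of a tuple in
    S_n. The tuples of type [nu], parametrised bijectively by [V], are the distinct rearrangements
    of [padded n nu]. *)
Lemma card_col_type (U : finType) n k (V : U -> 'I_n -> {mset letter k})
    (nu : mpart k) :
  mset0 \notin nu -> size nu <= n ->
  (forall u u', V u =1 V u' -> u = u') ->
  (forall v, col_type v = nu -> exists u, V u =1 v) ->
  #|[pred u | col_type (V u) == nu]| * (mult_fact nu * (n - size nu)`!) = n`!.
Proof.
move=> nu0 nun V_inj V_surj.
rewrite -[in RHS](size_padded nun) -size_permutations_mult_fact.
rewrite mult_fact_cat_nseq // (mulnC (mult_fact nu)); congr (_ * _).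
pose F u := [seq V u i | i <- enum 'I_n].
have F_inj : injective F.
  by move=> u u' /eq_in_map FE; apply: V_inj => i; rewrite FE ?mem_enum.
rewrite cardE -(size_map F); apply: perm_size; apply: uniq_perm.
- by rewrite map_inj_uniq ?enum_uniq.
- exact: permutations_uniq.
move=> s; rewrite mem_permutations; apply/mapP/idP => [[u]|sP].
  by rewrite mem_enum inE col_typeP // => + ->.
have s_size : size s = n by rewrite (perm_size sP) size_padded.
have sE := map_nth_ord mset0 s_size.
have [|u uE] := V_surj (fun i => nth mset0 s i).
  by apply/eqP; rewrite col_typeP // sE.
exists u; last by rewrite -{1}sE; apply: eq_map => i; rewrite uE.
by rewrite mem_enum inE col_typeP //= (eq_map uE) sE.
Qed.

(** * Structure constants as quotients of factorials *)

Lemma middle_block k (T : {mset letter k}) :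
  all (fun x : letter k => x.1 == 1 :> nat) T = (restr_block [:: 0; 2] T == mset0).
Proof.
rewrite mset_nil /nilp size_seq_mset size_filter eqn0Ngt -has_count -all_predC.
by apply: eq_all => -[[[|[|[|//]]] ?] j].
Qed.

Lemma restr_mult k (nu : mpart k) (S : {mset letter k}) :
  S != mset0 -> restr [:: 0; 2] nu S = size (fiber nu S).
Proof.
move=> S0; rewrite mset_seqE count_filter count_map size_seq_mset size_filter.
by apply: eq_count => T /=; case: eqP => // ->; rewrite S0.
Qed.

Lemma restr_neq0 k B (nu : mpart k) : mset0 \notin restr B nu.
Proof. by rewrite mem_seq_mset mem_filter eqxx. Qed.

(** A block either survives the restriction or lies entirely in [\bar k]. *)
Lemma size_restr_middle k (nu : mpart k) :
  size (restr [:: 0; 2] nu) + size (middle nu) = size nu.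
Proof.
rewrite !size_seq_mset !size_filter count_map addnC.
rewrite -[RHS](count_predC (fun T => restr_block [:: 0; 2] T == mset0)).
by congr (_ + _); apply: eq_count => T; rewrite middle_block.
Qed.

Lemma mfact_filter k (nu : mpart k) (p : pred {mset letter k}) :
  mfact (seq_mset [seq T <- nu | p T]) = \prod_(T <- finsupp nu | p T) (nu T)`!.
Proof.
rewrite mfactE (@mult_factE _ _ (finsupp nu)) ?fset_uniq //; last first.
  by move=> T; rewrite mem_filter multiset.msuppE => /andP[].
rewrite [RHS]big_mkcond; apply: eq_bigr => T _; rewrite count_filter.
rewrite -[in RHS]count_mem_mset; case: (boolP (p T)) => pT.
  by congr (_`!); apply: eq_count => S /=; case: eqP => // ->.
rewrite (eq_count (a2 := pred0)) ?count_pred0 // => S /=.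
by case: eqP => // ->; rewrite (negPf pT).
Qed.

Lemma mfact_mult_fact k (nu : mpart k) : mfact nu = mult_fact nu.
Proof. by rewrite -mfactE seq_mset_id. Qed.

(** The numerators of a_nu multiply to m(rho)! for rho the restriction, as the size of a fiber is
    the multiplicity of its block in rho. *)
Lemma prod_fact_fiber k (nu : mpart k) :
  \prod_(S <- finsupp (restr [:: 0; 2] nu)) (size (fiber nu S))`!
    = mult_fact (restr [:: 0; 2] nu).
Proof.
rewrite -mfact_mult_fact /mfact big_seq [RHS]big_seq; apply: eq_bigr => S.
rewrite multiset.msuppE => Srho; rewrite restr_mult //.
by apply: contraNneq (restr_neq0 [:: 0; 2] nu) => <-.
Qed.

(** The denominators of a_nu and b_nu multiply to m(nu)!: each distinct block of [nu] lies in the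
    fiber over its restriction or, if that is empty, in [middle nu]. *)
Lemma mult_fact_fiber k (nu : mpart k) :
  (\prod_(S <- finsupp (restr [:: 0; 2] nu)) mfact (fiber nu S))
    * mfact (middle nu) = mult_fact nu.
Proof.
rewrite -mfact_mult_fact [RHS]/mfact.
rewrite [RHS](bigID (fun T => restr_block [:: 0; 2] T == mset0)) /= mulnC.
congr (_ * _).
  rewrite mfact_filter; apply: eq_bigl => T; exact: middle_block.
under eq_bigr do rewrite mfact_filter.
(* After the exchange, the inner product over [S] has a single term, the restriction of [T]. *)
rewrite big_seq (exchange_big_dep (fun T => restr_block [:: 0; 2] T != mset0)) /=.
  rewrite big_seq_cond [RHS]big_seq_cond; apply: eq_bigr => T /andP[Tnu T0].
  rewrite -big_seq_cond; under eq_bigl do rewrite eq_sym.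
  rewrite -big_filter filter_pred1_uniq ?fset_uniq ?big_seq1 //.
  rewrite multiset.msuppE mem_seq_mset mem_filter T0.
  by apply: map_f; rewrite -multiset.msuppE.
move=> S T Srho /eqP TS; rewrite TS.
apply: contraNneq (restr_neq0 [:: 0; 2] nu) => <-.
by rewrite -multiset.msuppE.
Qed.

Section StructureConstants.
Local Open Scope ring_scope.

Lemma fallingE (C : fieldType) (a s : nat) :
  falling (a%:R : C) s = (a ^_ s)%:R.
Proof.
elim: s => [|s IH]; first by rewrite /falling big_ord0 ffactn0.
rewrite /falling big_ord_recr /= -/(falling _ _) IH ffactnSr natrM.
(* For s > a the truncated difference a - s is not the one in the field, but [a ^_ s] is already
   0. *)
have [sa|as_] := leqP s a; first by rewrite natrB.
by rewrite ffact_small // !mul0r.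
Qed.

(** The bound makes n - l(rho) a difference of natural numbers, so that the falling factorial is a
    natural number too. The remaining factorials regroup into m(rho)! and m(nu)!. *)
Lemma struct_coefE (C : numFieldType) n k (nu : mpart k) :
  (size (restr [:: 0; 2]%N nu) <= n)%N ->
  a_coef C nu * b_coef nu (n%:R : C)
    = (mult_fact (restr [:: 0; 2]%N nu)
        * (n - size (restr [:: 0; 2]%N nu)) ^_ (size (middle nu)))%:R
      / (mult_fact nu)%:R.
Proof.
move=> le_n; rewrite /a_coef /b_coef -natrB // fallingE natrM.
rewrite -prod_fact_fiber -mult_fact_fiber big_split /= prodfV.
by rewrite -!natr_prod mulf_div natrM.
Qed.

End StructureConstants.

(** * Tuples of monomials as tuples of columns *)

Definition fun_mset (T : finType) (f : T -> nat) : {mset T} :=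
  seq_mset (flatten [seq nseq (f x) x | x <- enum T]).

Lemma fun_msetE (T : finType) (f : T -> nat) x : fun_mset f x = f x.
Proof.
rewrite mset_seqE count_flatten sumnE 2!big_map big_enum /=.
rewrite (bigD1 x) //= count_nseq /= eqxx mul1n big1 ?addn0 // => y yx.
by rewrite count_nseq /= (negPf yx) mul0n.
Qed.

(* The multiplicity of (b, j) in column i is the exponent of x_ij in the b-th
   monomial of ms, missing monomials counting as 1. *)
Definition cols n k (ms : seq 'X_{1..n * k}) (i : 'I_n) : {mset letter k} :=
  fun_mset (fun x : letter k => nth 0%MM ms x.1 (mxvec_index i x.2)).

Definition ctype n k (ms : seq 'X_{1..n * k}) : mpart k := col_type (cols ms).

Definition grid n k (f : 'I_n -> 'I_k -> nat) : 'X_{1..n * k} :=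
  [multinom mxvec (\matrix_(i, j) f i j) 0%R l | l < n * k].

Lemma gridE n k (f : 'I_n -> 'I_k -> nat) i j :
  grid f (mxvec_index i j) = f i j.
Proof. by rewrite mnmE mxvecE mxE. Qed.

Lemma mnm_gridP n k (m m' : 'X_{1..n * k}) :
  (forall i j, m (mxvec_index i j) = m' (mxvec_index i j)) -> m = m'.
Proof. by move=> mm'; apply/mnmP => l; case/mxvec_indexP: l. Qed.

Lemma big_mxvec_index (R : Type) (idx : R) (op : Monoid.com_law idx) n k
    (F : 'I_(n * k) -> R) :
  \big[op/idx]_l F l = \big[op/idx]_i \big[op/idx]_j F (mxvec_index i j).
Proof.
rewrite pair_big /= (reindex (uncurry (@mxvec_index n k))) /=.
  by apply: eq_bigr => -[i j].
by have [g h1 h2] := curry_mxvec_bij n k; exists g => p _; [apply: h1|apply: h2].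
Qed.

Lemma mdeg_grid n k (m : 'X_{1..n * k}) :
  mdeg m = \sum_i \sum_j m (mxvec_index i j).
Proof. by rewrite mdegE big_mxvec_index. Qed.

Lemma count_cols n k (ms : seq 'X_{1..n * k}) (b : 'I_3) :
  \sum_i count (fun x : letter k => x.1 == b) (cols ms i) = mdeg (nth 0%MM ms b).
Proof.
rewrite mdeg_grid; apply: eq_bigr => i _.
rewrite count_sum_mem.
transitivity (\sum_(c | c == b) \sum_j count_mem (c, j) (cols ms i)); last first.
  by rewrite big_pred1_eq; apply: eq_bigr => j _; rewrite count_mem_mset fun_msetE.
by rewrite pair_big; apply: eq_big => -[c j] //=; rewrite andbT.
Qed.

(** The degree condition of [is_mpart] with arbitrary degrees, so that it also covers restrictions
    to [k] and [\bar\bar k], where the middle alphabet is missing. *)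
Definition profile k (d : 'I_3 -> nat) (nu : mpart k) : bool :=
  [forall b : 'I_3, count (fun x : letter k => x.1 == b) (munion nu) == d b].

Lemma ctype_profile n k (ms : seq 'X_{1..n * k}) (d : 'I_3 -> nat) :
  profile d (ctype ms) = [forall b : 'I_3, mdeg (nth 0%MM ms b) == d b].
Proof. by apply: eq_forallb => b; rewrite count_munion_col_type count_cols. Qed.

Lemma cols_surj n k (v : 'I_n -> {mset letter k}) :
  exists m0 m1 m2 : 'X_{1..n * k}, cols [:: m0; m1; m2] =1 v.
Proof.
pose m b := grid (fun (i : 'I_n) j => v i (b, j)).
exists (m 0%R), (m 1%R), (m 2%R) => i; apply/msetP => -[b j].
rewrite fun_msetE /=.
suff -> : nth 0%MM [:: m 0%R; m 1%R; m 2%R] b = m b by rewrite gridE.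
by case: b => [[|[|[|//]]] ?] /=; congr m; apply: val_inj.
Qed.

Lemma cols_inj n k (ms ms' : seq 'X_{1..n * k}) (b : 'I_3) :
  cols ms =1 cols ms' -> nth 0%MM ms b = nth 0%MM ms' b.
Proof.
move=> e; apply: mnm_gridP => i j; have /msetP/(_ (b, j)) := e i.
by rewrite !fun_msetE.
Qed.

(** On exponents this is the inverse of [sym_act]: substituting x_(s i)j for x_ij turns the monomial
    of [rowperm s m] into that of [m]. *)
Definition rowperm n k (s : 'S_n) (m : 'X_{1..n * k}) : 'X_{1..n * k} :=
  grid (fun i j => m (mxvec_index (s i) j)).

Lemma rowpermK n k (s : 'S_n) :
  cancel (@rowperm n k s) (rowperm s^-1%g).
Proof. by move=> m; apply: mnm_gridP => i j; rewrite !gridE permKV. Qed.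

Lemma rowpermKV n k (s : 'S_n) :
  cancel (@rowperm n k s^-1%g) (rowperm s).
Proof. by move=> m; apply: mnm_gridP => i j; rewrite !gridE permK. Qed.

Lemma mdeg_rowperm n k (s : 'S_n) (m : 'X_{1..n * k}) : mdeg (rowperm s m) = mdeg m.
Proof.
rewrite !mdeg_grid [RHS](reindex_inj (@perm_inj _ s)) /=.
by apply: eq_bigr => i _; apply: eq_bigr => j _; rewrite gridE.
Qed.

Lemma cols_rowperm n k (s : 'S_n) (ms : seq 'X_{1..n * k}) i :
  cols (map (rowperm s) ms) i = cols ms (s i).
Proof.
apply/msetP => -[b j]; rewrite !fun_msetE /=.
have [lt_b|ge_b] := ltnP b (size ms).
  by rewrite (nth_map 0%MM) // gridE.
by rewrite !nth_default ?size_map // !mnm0E.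
Qed.

Lemma ctype_rowperm n k (s : 'S_n) (ms : seq 'X_{1..n * k}) :
  ctype (map (rowperm s) ms) = ctype ms.
Proof.
by rewrite /ctype (eq_col_type (cols_rowperm s ms)) col_type_perm.
Qed.

(** One permutation serves all the monomials at once, because a column records its exponents in all
    of them. *)
Lemma ctype_eq_rowperm n k (ms ms' : seq 'X_{1..n * k}) :
  ctype ms = ctype ms' ->
  exists s : 'S_n, forall b : 'I_3, nth 0%MM ms' b = rowperm s (nth 0%MM ms b).
Proof.
move=> /col_type_eq_perm[s e]; exists s => b'; apply: mnm_gridP => i j.
rewrite gridE; have /msetP/(_ (b', j)) := e i.
by rewrite !fun_msetE.
Qed.

(** Discarding an alphabet has the same effect on every column as replacing its monomial by 1. *)
Lemma restr_ctype n k (B : seq nat) (ms : seq 'X_{1..n * k}) :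
  restr B (ctype ms)
    = ctype [seq (if b \in B then nth 0%MM ms b else 0%MM) | b <- iota 0 3].
Proof.
rewrite /ctype restr_col_type; apply: eq_col_type => i; apply/msetP => x.
rewrite restr_blockE !fun_msetE (nth_map 0) ?size_iota //.
by rewrite nth_iota // add0n; case: ifP => //; rewrite mnm0E.
Qed.

Lemma eq_ctype n k (ms ms' : seq 'X_{1..n * k}) :
  (forall b : 'I_3, nth 0%MM ms b = nth 0%MM ms' b) -> ctype ms = ctype ms'.
Proof.
move=> e; apply: eq_col_type => i; apply/msetP => x.
by rewrite !fun_msetE e.
Qed.


(** Each block, being non-empty, uses up at least one letter. *)
Lemma size_mpart_munion k (nu : mpart k) (d : 'I_3 -> nat) :
  mset0 \notin nu -> profile d nu -> size nu <= \sum_b d b.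
Proof.
move=> nu0 /forallP nud.
have -> : \sum_b d b = size (munion nu).
  rewrite -count_predT count_sum_mem.
  transitivity (\sum_b \sum_j count_mem (b, j) (munion nu)); last first.
    by rewrite pair_big; apply: eq_big => -[c j].
  apply: eq_bigr => b _; rewrite -(eqP (nud b)) count_sum_mem.
  transitivity (\sum_(c | c == b) \sum_j count_mem (c, j) (munion nu)).
    by rewrite pair_big; apply: eq_big => -[c j] //=; rewrite andbT.
  by rewrite big_pred1_eq.
rewrite -(count_predT (munion nu)) count_munion -sum1_size big_seq [leqRHS]big_seq.
apply: leq_sum => T Tnu; rewrite count_predT lt0n.
by apply: contraNneq nu0 => /size0nil/nilP; rewrite -mset_nil => /eqP <-.
Qed.

(** * Counting pairs and triples of monomials by type *)

Section HomogeneousMonomials.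
Variables (n k r : nat).
Local Notation M := (hmonom n k r).

Definition hm (x : M) : 'X_{1..n * k} := val (val x).

Lemma mdeg_hm (x : M) : mdeg (hm x) = r.
Proof. exact/eqP/(valP x). Qed.

Lemma hm_inj : injective hm.
Proof. by move=> x y /val_inj/val_inj. Qed.

Lemma hmP (m : 'X_{1..n * k}) : mdeg m = r -> exists x, hm x = m.
Proof.
move=> mr; have lt_m : mdeg m < r.+1 by rewrite mr.
have hmr : mdeg (BMultinom lt_m) == r by rewrite /= mr.
by exists (Sub (BMultinom lt_m) hmr).
Qed.

Lemma hm_permP (s : 'S_n) (x : M) : exists y, hm y = rowperm s (hm x).
Proof. by apply: hmP; rewrite mdeg_rowperm mdeg_hm. Qed.

Lemma card_ctype3 (nu : mpart k) :
  mset0 \notin nu -> profile (fun=> r) nu -> size nu <= n ->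
  #|[pred u : M * M * M | ctype [:: hm u.1.1; hm u.1.2; hm u.2] == nu]|
    * (mult_fact nu * (n - size nu)`!) = n`!.
Proof.
move=> nu0 nur nun.
apply: (@card_col_type _ _ _ (fun u : M * M * M => cols [:: hm u.1.1; hm u.1.2; hm u.2])) => //.
  move=> [[x y] z] [[x' y'] z'] e.
  have /hm_inj /= -> := @cols_inj _ _ _ _ ord0 e.
  have /hm_inj /= -> := @cols_inj _ _ _ _ (Ordinal (isT : 1 < 3)) e.
  by have /hm_inj /= -> := @cols_inj _ _ _ _ ord_max e.
move=> v vnu; have [m0 [m1 [m2 mv]]] := cols_surj v.
have := nur; rewrite -vnu -(eq_col_type mv) ctype_profile => /forallP h.
have [x xE] := hmP (eqP (h ord0)).
have [y yE] := hmP (eqP (h (Ordinal (isT : 1 < 3)))).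
have [z zE] := hmP (eqP (h ord_max)).
by exists (x, y, z) => i /=; rewrite xE yE zE /= mv.
Qed.

(** Here [rho] keeps its double bars, as a restriction of some nu does, so the middle monomial is
    1. *)
Lemma card_ctype2 (rho : mpart k) :
  mset0 \notin rho -> profile (fun b => if b == 1 :> nat then 0 else r) rho ->
  size rho <= n ->
  #|[pred u : M * M | ctype [:: hm u.1; 0%MM; hm u.2] == rho]|
    * (mult_fact rho * (n - size rho)`!) = n`!.
Proof.
move=> rho0 rhor rhon.
apply: (@card_col_type _ _ _ (fun u : M * M => cols [:: hm u.1; 0%MM; hm u.2])) => //.
  move=> [x z] [x' z'] e.
  have /hm_inj /= -> := @cols_inj _ _ _ _ ord0 e.
  by have /hm_inj /= -> := @cols_inj _ _ _ _ ord_max e.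
move=> v vrho; have [m0 [m1 [m2 mv]]] := cols_surj v.
have := rhor; rewrite -vrho -(eq_col_type mv) ctype_profile => /forallP h.
have [x xE] := hmP (eqP (h ord0)).
have m1E : m1 = 0%MM by apply/eqP; rewrite -mdeg_eq0 (h (Ordinal (isT : 1 < 3))).
have [z zE] := hmP (eqP (h ord_max)).
by exists (x, z) => i /=; rewrite xE zE /= -mv m1E.
Qed.

Lemma ctype_hm3_is_mpart (x y z : M) : is_mpart 3 r (ctype [:: hm x; hm y; hm z]).
Proof.
rewrite /is_mpart col_type_mset0 /= -/(profile _ _) ctype_profile.
by apply/forallP => -[[|[|[|//]]] ?] /=; rewrite mdeg_hm.
Qed.

Lemma ctype_hm2_is_mpart (x y : M) : is_mpart 2 r (ctype [:: hm x; hm y]).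
Proof.
rewrite /is_mpart col_type_mset0 /= -/(profile _ _) ctype_profile.
by apply/forallP => -[[|[|[|//]]] ?] /=; rewrite ?mdeg_hm ?mdeg0.
Qed.

Definition mtype3 (x y z : M) : mparts 3 r k := MParts (ctype_hm3_is_mpart x y z).
Definition mtype (x y : M) : mparts 2 r k := MParts (ctype_hm2_is_mpart x y).

(** This is where n >= 2r enters: a partition of 2r letters has at most 2r blocks, so it fits into n
    columns. *)
Lemma mtype_surj (pi : mparts 2 r k) : 2 * r <= n -> exists x y, mtype x y = pi.
Proof.
move=> rn; have /andP[pi0 pir] := mpart_ofP pi.
have pin : size pi <= n.
  apply: leq_trans (size_mpart_munion pi0 pir) _.
  by rewrite !big_ord_recr big_ord0 /= !addn0 add0n addnn -mul2n.
have [v vpi] := col_type_surj pi0 pin; have [m0 [m1 [m2 mv]]] := cols_surj v.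
have := pir; rewrite -/(profile _ _) -vpi -(eq_col_type mv) ctype_profile => /forallP h.
have [x xE] := hmP (eqP (h ord0)).
have [y yE] := hmP (eqP (h (Ordinal (isT : 1 < 3)))).
have m2E : m2 = 0%MM by apply/eqP; rewrite -mdeg_eq0 (h ord_max).
exists x, y; apply: val_inj => /=; rewrite xE yE -vpi -(eq_col_type mv) m2E.
by apply: eq_ctype => -[[|[|[|//]]] ?].
Qed.

Lemma mtype_eq_perm (x y x' y' : M) : mtype x y = mtype x' y' ->
  exists s : 'S_n, hm x' = rowperm s (hm x) /\ hm y' = rowperm s (hm y).
Proof.
move=> /(congr1 (@mpart_of _ _ _)) /= /ctype_eq_rowperm[s e]; exists s.
by split; [apply: (e ord0)|apply: (e (Ordinal (isT : 1 < 3)))].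
Qed.

Lemma mtype_perm (s : 'S_n) (x y x' y' : M) :
  hm x' = rowperm s (hm x) -> hm y' = rowperm s (hm y) -> mtype x' y' = mtype x y.
Proof.
move=> xE yE; apply: val_inj => /=.
by rewrite xE yE -[RHS](ctype_rowperm s).
Qed.

(** The contribution of [nu] to the entry at (x, z) of a product of two orbit matrices. *)
Definition nfill (nu : mpart k) (x z : M) : nat :=
  #|[pred y : M | ctype [:: hm x; hm y; hm z] == nu]|.

Lemma nfill_neq0 (nu : mpart k) (x z : M) : nfill nu x z != 0 ->
  ctype [:: hm x; 0%MM; hm z] = restr [:: 0; 2] nu /\ size nu <= n.
Proof.
rewrite /nfill -lt0n => /card_gt0P[y]; rewrite inE => /eqP <-.
by rewrite restr_ctype col_type_size.
Qed.

(** A permutation carrying one pair to the other also carries the middle monomials over, bijectively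
    and without changing the type of the triple. *)
Lemma nfill_const (nu : mpart k) (x z x' z' : M) :
  ctype [:: hm x; 0%MM; hm z] = ctype [:: hm x'; 0%MM; hm z'] ->
  nfill nu x z = nfill nu x' z'.
Proof.
move=> /ctype_eq_rowperm[s e].
have xE : hm x' = rowperm s (hm x) := e ord0.
have zE : hm z' = rowperm s (hm z) := e ord_max.
have [g gE] : exists g : M -> M, forall y, hm (g y) = rowperm s (hm y).
  by apply: (fin_all_exists (fun y => hm_permP s y)).
have g_inj : injective g.
  by move=> y y' /(congr1 hm); rewrite !gE => /(can_inj (rowpermK s))/hm_inj.
rewrite /nfill -[RHS](on_card_preimset (f := g)); last first.
  exact: onW_bij (injF_bij g_inj).
apply: eq_card => y; rewrite !inE /= xE zE gE.
by rewrite -(ctype_rowperm s).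
Qed.

(** Double counting: the triples of type [nu] lie over the pairs of type rho, and by [nfill_const]
    all these pairs have equally many fillings. Cancelling the number of pairs from the two orbit
    counts gives the formula. *)
Lemma nfillE (nu : mpart k) (x z : M) :
  mset0 \notin nu -> profile (fun=> r) nu -> size nu <= n ->
  ctype [:: hm x; 0%MM; hm z] = restr [:: 0; 2] nu ->
  nfill nu x z * (mult_fact nu * (n - size nu)`!)
    = mult_fact (restr [:: 0; 2] nu) * (n - size (restr [:: 0; 2] nu))`!.
Proof.
move=> nu0 nur nun xz; set rho := restr _ nu in xz *.
have rho0 : mset0 \notin rho by rewrite -xz col_type_mset0.
have rhor : profile (fun b => if b == 1 :> nat then 0 else r) rho.
  rewrite -xz ctype_profile.
  by apply/forallP => -[[|[|[|//]]] ?] /=; rewrite ?mdeg_hm ?mdeg0.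
have rhon : size rho <= n by rewrite -xz col_type_size.
have := card_ctype2 rho0 rhor rhon.
rewrite -(card_ctype3 nu0 nur nun).
set B := #|_|; set A := #|_|.
have B_gt0 : 0 < B by apply/card_gt0P; exists (x, z); rewrite inE /= xz.
suff -> : A = B * nfill nu x z.
  by rewrite -!mulnA => /eqP; rewrite eqn_pmul2l // => /eqP.
rewrite /A -sum1_card /=.
transitivity (\sum_(p : M * M) nfill nu p.1 p.2).
  under [RHS]eq_bigr do rewrite /nfill -sum1_card.
  rewrite pair_big_dep /=.
  (* Triples (x, y, z) are regrouped as a pair (x, z) with a filling y. *)
  rewrite (reindex (fun q : M * M * M => (q.1.1, q.2, q.1.2))) /=.
    by apply: eq_bigl => -[[? ?] ?].
  by exists (fun q : M * M * M => (q.1.1, q.2, q.1.2)) => -[[? ?] ?].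
(* Pairs of another type have no filling; the others have as many as (x, z). *)
rewrite (bigID (fun p : M * M => ctype [:: hm p.1; 0%MM; hm p.2] == rho)) /=.
rewrite [X in _ + X]big1 ?addn0 => [|p prho]; last first.
  apply/eqP; apply: contraNT prho => /nfill_neq0[-> _]; exact: eqxx.
rewrite (eq_bigr (fun=> nfill nu x z)) => [|p /eqP pE]; last first.
  by apply: nfill_const; rewrite pE.
by rewrite sum_nat_const.
Qed.

End HomogeneousMonomials.

(** * Changing the number of bars *)

(** When [g] merges alphabets, the multiplicities of their letters add up, so the corresponding
    monomials are multiplied. *)
Lemma relabel_ctype n k (f : letter k -> letter k) (g : 'I_3 -> 'I_3)
    (ms ms' : seq 'X_{1..n * k}) :
  (forall x, f x = (g x.1, x.2)) ->
  (forall (b : 'I_3) l,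
    nth 0%MM ms' b l = \sum_(c : 'I_3 | g c == b) nth 0%MM ms c l) ->
  relabel f (ctype ms) = ctype ms'.
Proof.
move=> fg ms'E; rewrite /ctype relabel_col_type; apply: eq_col_type => i.
apply/msetP => -[b j]; rewrite relabel_blockE fun_msetE ms'E /=.
transitivity (\sum_(c | g c == b) \sum_(j' | j' == j)
    nth 0%MM ms c (mxvec_index i j')); last first.
  by apply: eq_bigr => c _; rewrite big_pred1_eq.
by rewrite pair_big; apply: eq_big => -[c j'] //=; rewrite ?fun_msetE ?fg.
Qed.

(** Inverts [unbar2] on letters with 0 or 2 bars, so that removing the bar loses no information on a
    restriction. *)
Definition rebar2 k (x : letter k) : letter k :=
  (if x.1 == 1 :> nat then ord_max else x.1, x.2).

Lemma inord1 : inord 1 = Ordinal (isT : 1 < 3).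
Proof. by apply: val_inj; rewrite /= inordK. Qed.

Lemma relabel_add_bar_ctype n k (m m' : 'X_{1..n * k}) :
  relabel (@add_bar k) (ctype [:: m; m']) = ctype [:: 0%MM; m; m'].
Proof.
apply: (@relabel_ctype _ _ _ (@ordS 3)) => // b l.
rewrite big_mkcond !big_ord_recl big_ord0 /= addn0.
by case: b => [[|[|[|//]]] ?]; rewrite /= ?mnm0E ?addn0.
Qed.

Lemma relabel_unbar2_ctype n k (m m' : 'X_{1..n * k}) :
  relabel (@unbar2 k) (ctype [:: m; 0%MM; m']) = ctype [:: m; m'].
Proof.
apply: (@relabel_ctype _ _ _ (fun b => if b == 2 :> nat then inord 1 else b)).
  by move=> [b j]; rewrite /unbar2 /=; case: ifP.
move=> b l; rewrite big_mkcond !big_ord_recl big_ord0 /= addn0 inord1.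
by case: b => [[|[|[|//]]] ?]; rewrite /= ?mnm0E ?addn0.
Qed.

Lemma relabel_rebar2_ctype n k (m m' : 'X_{1..n * k}) :
  relabel (@rebar2 k) (ctype [:: m; m']) = ctype [:: m; 0%MM; m'].
Proof.
apply: (@relabel_ctype _ _ _ (fun b => if b == 1 :> nat then ord_max else b)) => //.
move=> b l; rewrite big_mkcond !big_ord_recl big_ord0 /= addn0.
by case: b => [[|[|[|//]]] ?]; rewrite /= ?mnm0E ?addn0.
Qed.

Lemma munion_restr k B (nu : mpart k) x :
  x \in munion (restr B nu) -> (x.1 : nat) \in B.
Proof.
rewrite mem_seq_mset => /flattenP[_ /mapP[T + ->]].
rewrite mem_seq_mset mem_filter => /andP[_ /mapP[S _ ->]].
by rewrite mem_seq_mset mem_filter => /andP[].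
Qed.

Lemma relabel_rebar2K k (nu : mpart k) :
  relabel (@rebar2 k) (relabel (@unbar2 k) (restr [:: 0; 2] nu))
    = restr [:: 0; 2] nu.
Proof.
apply: relabelK_in => -[b j] /munion_restr /=.
case: b => [[|[|[|//]]] ?] //= _; rewrite /unbar2 /rebar2 /= ?inord1 /=.
  by congr (_, _); apply: val_inj.
Qed.

(** [ordS] is the cyclic shift of the three alphabets, hence invertible on all letters. *)
Lemma relabel_add_bar_inj k : injective (relabel (@add_bar k)).
Proof.
apply: (can_inj (g := relabel (fun x : letter k => (ord_pred x.1, x.2)))) => nu.
by apply: relabelK_in => -[b j] _; rewrite /add_bar /= ordSK.
Qed.

(** * Structure constants as numbers of middle monomials *)

Section Product.
Variables (n k r : nat).
Local Notation M := (hmonom n k r).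

Lemma mtype_outer (nu : mparts 3 r k) (x z : M) :
  (mtype x z == outer nu)
    = (ctype [:: hm x; 0%MM; hm z] == restr [:: 0; 2] nu).
Proof.
apply/eqP/eqP => [/(congr1 (@mpart_of _ _ _)) /= e|e].
  by rewrite -relabel_rebar2K -e relabel_rebar2_ctype.
by apply: val_inj; rewrite /= -e relabel_unbar2_ctype.
Qed.

Local Open Scope ring_scope.

(** If (x, z) has the wrong type both sides vanish; otherwise the coefficient is the quotient of
    orbit sizes found in [nfillE]. *)
Lemma nfill_coef (C : numFieldType) (nu : mparts 3 r k) (x z : M) :
  (nfill nu x z)%:R
    = (a_coef C nu * b_coef nu (n%:R : C)) * (outer nu == mtype x z)%:R.
Proof.
have /andP[nu0 nur] := mpart_ofP nu.
have {}nur : profile (fun=> r) nu.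
  by apply/forallP => b; rewrite (eqP (forallP nur b)) ltn_ord.
rewrite eq_sym mtype_outer; case: eqP => [e|ne]; last first.
  rewrite mulr0 (_ : nfill nu x z = 0%N) //; apply/eqP.
  by apply/negPn/negP => /nfill_neq0[].
have rhon : (size (restr [:: 0; 2] nu) <= n)%N by rewrite -e col_type_size.
rewrite mulr1 struct_coefE //.
suff NE : (nfill nu x z * mult_fact nu = mult_fact (restr [:: 0; 2] nu) *
    (n - size (restr [:: 0; 2] nu)) ^_ (size (middle nu)))%N.
  by rewrite -NE natrM mulfK // pnatr_eq0 -lt0n mult_fact_gt0.
(* If l(nu) = l(rho) + l(beta) exceeds n, the falling factorial is 0 and no n columns have type
   [nu]. *)
have [nun|nun] := leqP (size nu) n; last first.
  rewrite ffact_small ?muln0; last by rewrite ltn_subLR // size_restr_middle.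
  rewrite (_ : nfill nu x z = 0%N) //; apply/eqP/negPn/negP => /nfill_neq0[_].
  by rewrite leqNgt nun.
(* Multiplying by (n - l(nu))! completes the falling factorial to (n - l(rho))!, the form given by
   [nfillE]. *)
apply/eqP; rewrite -(eqn_pmul2r (fact_gt0 (n - size nu))) -mulnA nfillE //.
have -> : (n - size nu = n - size (restr [:: 0; 2] nu) - size (middle nu))%N.
  by rewrite -subnDA size_restr_middle.
rewrite -mulnA ffact_fact //.
by rewrite leq_subRL // size_restr_middle.
Qed.

(** Each y is counted for exactly one nu, the type of (x, y, z), whose two restrictions are the
    types of (x, y) and, after adding a bar, of (y, z). *)
Lemma card_mtype_pair (x z : M) (pi gamma : mparts 2 r k) :
  #|[pred y | (mtype x y == pi) && (mtype y z == gamma)]| =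
  (\sum_(nu : mparts 3 r k | (restr [:: 0; 1] nu == mpart_of pi)
                         && (restr [:: 1; 2] nu == relabel (@add_bar k) gamma))
     nfill nu x z)%N.
Proof.
under eq_bigr do rewrite /nfill -sum1_card /= big_mkcond.
rewrite exchange_big /= -sum1_card big_mkcond; apply: eq_bigr => y _.
rewrite -big_mkcondr (eq_bigl (fun nu => (mtype3 x y z == nu)
   && ((mtype x y == pi) && (mtype y z == gamma)))) => [|nu]; last first.
  rewrite [LHS]andbC inE -(inj_eq val_inj (mtype3 x y z)) /=.
  case: (ctype _ =P _) => //= <-; rewrite !restr_ctype /= -relabel_add_bar_ctype.
  rewrite (inj_eq (@relabel_add_bar_inj k)) -!(inj_eq (val_inj : injective (@mpart_of 2 r k))) /=.
  by congr ((_ == _) && _); apply: eq_ctype => -[[|[|[|//]]] ?].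
rewrite inE.
by case: ifP => _; under eq_bigl do rewrite ?andbT eq_sym; rewrite ?big_pred1_eq ?big_pred0 // => nu; rewrite andbF.
Qed.

End Product.

Local Open Scope ring_scope.

(** * Operators as matrices in the monomial basis *)

Section Operators.
Variables (C : fieldType) (n k r : nat).
Local Notation M := (hmonom n k r).
Local Notation H := (hpoly C n k r).

Lemma hX_subproof (x : M) : 'X_[C, hm x] \is r.-homog.
Proof. by rewrite dhomogX /= mdeg_hm. Qed.

Definition hX (x : M) : H := DHomog (hX_subproof x).

Definition hcoef (x : M) (p : H) : C := (val p)@_(hm x).

Lemma hcoef_is_linear x : linear (hcoef x : H -> C^o).
Proof. by move=> c p q; rewrite /hcoef /= mcoeffD mcoeffZ. Qed.

HB.instance Definition _ x :=
  GRing.isLinear.Build C H C^o _ (hcoef x) (hcoef_is_linear x).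

Lemma hcoefZ x c (p : H) : hcoef x (c *: p) = c * hcoef x p.
Proof. exact: mcoeffZ. Qed.

Lemma hcoefX (x y : M) : hcoef x (hX y) = (x == y)%:R.
Proof. by rewrite /hcoef /= mcoeffX (inj_eq (@hm_inj n k r)) eq_sym. Qed.

Lemma hcoefP (p q : H) : (forall x, hcoef x p = hcoef x q) -> p = q.
Proof.
move=> pq; apply/val_inj/mpolyP => m.
have [/hmP[x <-]|mr] := eqVneq (mdeg m) r; first exact: pq.
by rewrite !(dhomog_nemf_coeff (valP _) mr).
Qed.

Lemma hpolyE (p : H) : p = \sum_x hcoef x p *: hX x.
Proof.
apply: hcoefP => x; rewrite linear_sum (bigD1 x) //= hcoefZ hcoefX eqxx.
rewrite mulr1 big1 ?addr0 // => y yx.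
by rewrite hcoefZ hcoefX eq_sym (negPf yx) mulr0.
Qed.

Definition opcoef (f : 'End(H)) (x y : M) : C := hcoef x (f (hX y)).

Lemma opcoefP (f g : 'End(H)) : opcoef f =2 opcoef g -> f = g.
Proof.
move=> fg; apply/lfunP => p; rewrite [p]hpolyE !linear_sum.
by apply: eq_bigr => y _; rewrite !linearZ; congr (_ *: _); apply: hcoefP => x; apply: fg.
Qed.

Lemma opcoefZD (c : C) (f g : 'End(H)) x y :
  opcoef (c *: f + g) x y = c * opcoef f x y + opcoef g x y.
Proof. by rewrite /opcoef add_lfunE scale_lfunE raddfD /= hcoefZ. Qed.

Lemma opcoef_comp (f g : 'End(H)) x z :
  opcoef (f \o g)%VF x z = \sum_y opcoef f x y * opcoef g y z.
Proof.
rewrite /opcoef comp_lfunE {1}[g _]hpolyE !linear_sum.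
by apply: eq_bigr => y _; rewrite linearZ /= hcoefZ mulrC.
Qed.

Definition mkop_fun (A : M -> M -> C) (p : H) : H :=
  \sum_y \sum_x (hcoef y p * A x y) *: hX x.

Lemma mkop_fun_is_linear A : linear (mkop_fun A).
Proof.
move=> c p q; rewrite /mkop_fun scaler_sumr -big_split /=; apply: eq_bigr => y _.
rewrite scaler_sumr -big_split /=; apply: eq_bigr => x _.
by rewrite linearP /= mulrDl scalerDl scalerA mulrA.
Qed.

HB.instance Definition _ A :=
  GRing.isLinear.Build C H H _ (mkop_fun A) (mkop_fun_is_linear A).

Definition mkop (A : M -> M -> C) : 'End(H) := linfun (mkop_fun A).

Lemma opcoef_mkop A x y : opcoef (mkop A) x y = A x y.
Proof.
rewrite /opcoef lfunE /= /mkop_fun linear_sum (bigD1 y) //= [X in _ + X]big1 => [|z zy].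
  rewrite addr0 linear_sum (bigD1 x) //= hcoefZ !hcoefX !eqxx mul1r.
  rewrite mulr1 big1 ?addr0 // => z zx.
  by rewrite hcoefZ hcoefX eq_sym (negPf zx) mulr0.
rewrite linear_sum big1 // => w _.
by rewrite /= hcoefZ !hcoefX (negPf zy) !mul0r.
Qed.

Lemma sym_act_hX (s : 'S_n) (x y : M) :
  hm x = rowperm s (hm y) -> sym_act s (hX x) = hX y.
Proof.
move=> xE; apply: val_inj => /=; rewrite comp_mpolyX [RHS]mpolyXE_id.
rewrite !big_mxvec_index [RHS](reindex_inj (@perm_inj _ s)) /=.
apply: eq_bigr => i _; apply: eq_bigr => j _.
by rewrite tnth_mktuple mxvecE mxE xE gridE.
Qed.

(** The default is never reached, since [rowperm] preserves the degree. *)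
Definition hperm (s : 'S_n) (x : M) : M :=
  odflt x [pick y | hm y == rowperm s (hm x)].

Lemma hm_hperm s x : hm (hperm s x) = rowperm s (hm x).
Proof.
rewrite /hperm; case: pickP => [y /eqP //|h].
by have [y yE] := hm_permP s x; have := h y; rewrite yE eqxx.
Qed.

Lemma hperm_inj s : injective (hperm s).
Proof.
move=> x y /(congr1 (@hm _ _ _)); rewrite !hm_hperm.
by move/(can_inj (rowpermK s))/hm_inj.
Qed.

(** The only monomial that [sym_act s] sends to [hX x] is the one indexed by [hperm s x]. *)
Lemma hcoef_sym_act (s : 'S_n) (x : M) (p : H) :
  hcoef x (sym_act s p) = hcoef (hperm s x) p.
Proof.
rewrite {1}[p]hpolyE !linear_sum /= (bigD1 (hperm s x)) //= big1 => [|y yx].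
  by rewrite addr0 linearZ /= hcoefZ (sym_act_hX (hm_hperm s x)) hcoefX eqxx mulr1.
have [z zE] := hm_permP s^-1%g y.
have yE : hm y = rowperm s (hm z) by rewrite zE rowpermKV.
rewrite linearZ /= hcoefZ (sym_act_hX yE) hcoefX; case: eqP => [xz|]; last by rewrite mulr0.
by case/eqP: yx; apply: hm_inj; rewrite hm_hperm xz.
Qed.

(** Commutation with s is tested on the vectors [hX (hperm s y)], which exhaust the basis because
    [hperm s] is bijective. *)
Lemma centralizesP (f : 'End(H)) :
  reflect (forall s x y, opcoef f (hperm s x) (hperm s y) = opcoef f x y)
    (f \in @centralizes C n k r).
Proof.
have comm_coef s x y : opcoef f (hperm s x) (hperm s y) = opcoef f x y <->
    hcoef x ((linfun (sym_act s) \o f)%VF (hX (hperm s y)))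
      = hcoef x ((f \o linfun (sym_act s))%VF (hX (hperm s y))).
  rewrite !comp_lfunE !lfunE /= hcoef_sym_act (sym_act_hX (hm_hperm s y)).
  by [].
apply: (iffP forallP) => [fP s x y|fP s].
  by apply/comm_coef; rewrite (eqP (fP s)).
apply/eqP/opcoefP => x y; have [g gK1 gK2] := injF_bij (@hperm_inj s).
by rewrite -(gK2 y); apply/esym/comm_coef.
Qed.

(** A matrix in the centralizer is constant on orbits of pairs, that is, a function of the type. *)
Lemma opcoef_mtype (f : centralizer C n k r) x y x' y' :
  mtype x y = mtype x' y' -> opcoef f x y = opcoef f x' y'.
Proof.
move=> /mtype_eq_perm[s [xE yE]]; have /centralizesP fP := centralizer_lfunP f.
rewrite -(fP s); congr (opcoef _ _ _); apply: hm_inj; by rewrite hm_hperm.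
Qed.

Lemma mkop_mtype_centralizes (v : MP C r k) :
  mkop (fun x y => v (mtype x y)) \in @centralizes C n k r.
Proof.
apply/centralizesP => s x y; rewrite !opcoef_mkop.
by rewrite (mtype_perm (hm_hperm s x) (hm_hperm s y)).
Qed.

Definition mp_op (v : MP C r k) : centralizer C n k r :=
  Centralizer (mkop_mtype_centralizes v).

Lemma opcoef_mp_op v x y : opcoef (mp_op v) x y = v (mtype x y).
Proof. exact: opcoef_mkop. Qed.

Lemma mp_op_is_linear : linear mp_op.
Proof.
move=> c v w; apply/val_inj/opcoefP => x y.
by rewrite [LHS]opcoef_mp_op opcoefZD !opcoef_mkop !ffunE.
Qed.

HB.instance Definition _ :=
  GRing.isLinear.Build C (MP C r k) (centralizer C n k r) _ mp_op mp_op_is_linear.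

(** The inverse reads off one entry per type, at a representative pair [g pi] supplied by
    [mtype_surj]. *)
Lemma mp_op_bij : (2 * r <= n)%N -> bijective mp_op.
Proof.
move=> rn.
have /fin_all_exists[g gE] : forall pi : mparts 2 r k,
    exists p : M * M, mtype p.1 p.2 = pi.
  move=> pi; by have [x [y xy]] := mtype_surj pi rn; exists (x, y).
exists (fun f : centralizer C n k r =>
    [ffun pi => opcoef f (g pi).1 (g pi).2] : MP C r k) => [v|f].
  by apply/ffunP => pi; rewrite ffunE opcoef_mp_op gE.
apply/val_inj/opcoefP => x y; rewrite [LHS]opcoef_mp_op ffunE.
by apply: opcoef_mtype; rewrite gE.
Qed.

End Operators.

(** * Multiplicativity and the isomorphism *)

Lemma mp_op_mul (C : numFieldType) n k r (v w : MP C r k) :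
  mp_op n (mp_mul n v w) = centralizer_mul (mp_op n v) (mp_op n w).
Proof.
apply/val_inj/opcoefP => x z; rewrite [LHS]opcoef_mp_op /= opcoef_comp.
under [RHS]eq_bigr do rewrite !opcoef_mkop.
(* Both products are compared with a sum over pairs of types, weighted by the number of middle
   monomials. *)
transitivity (\sum_pi \sum_gamma v pi * w gamma *
    #|[pred y | (mtype x y == pi) && (mtype y z == gamma)]|%:R).
  rewrite /mp_mul sum_ffunE; apply: eq_bigr => pi _.
  rewrite sum_ffunE; apply: eq_bigr => gamma _; rewrite ffunE; congr (_ * _).
  rewrite card_mtype_pair natr_sum /mp_mulX sum_ffunE; apply: eq_bigr => nu _.
  by rewrite !ffunE nfill_coef eq_sym.
(* For a fixed y only the types of (x, y) and (y, z) survive, which recovers the matrix product. *)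
transitivity (\sum_y \sum_pi \sum_gamma v pi * w gamma *
    ((mtype x y == pi) && (mtype y z == gamma))%:R); last first.
  apply: eq_bigr => y _.
  rewrite (bigD1 (mtype x y)) //= [X in _ + X]big1 => [|pi piP]; last first.
    by apply: big1 => gamma _; rewrite eq_sym (negPf piP) mulr0.
  rewrite addr0 (bigD1 (mtype y z)) //= [X in _ + X]big1 => [|gamma gP]; last first.
    by rewrite [mtype y z == _]eq_sym (negPf gP) andbF mulr0.
  by rewrite !eqxx mulr1 addr0.
rewrite [RHS]exchange_big /=; apply: eq_bigr => pi _.
rewrite [RHS]exchange_big /=; apply: eq_bigr => gamma _.
rewrite -mulr_sumr -sum1_card natr_sum big_mkcond; congr (_ * _).
by apply: eq_bigr => y _; rewrite inE; case: ifP.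
Qed.

Theorem theorem4p7 (R : realType) (n k r : nat)
    (hn : (0 < n)%N) (hk : (0 < k)%N) (hr : (0 < r)%N) (hnr : (2 * r <= n)%N) :
  @algebra_isomorphic R[i] (MP R[i] r k) (centralizer R[i] n k r)
    (@mp_mul R[i] r k n) (@centralizer_mul R[i] n k r).
Proof.
exists (@mp_op R[i] n k r); split; first exact: mp_op_bij.
exact: mp_op_mul.
Qed.
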